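(* Let $r\ge3$ and $p=p(n)\in(0,1]$. Then with high probability as $n\to\infty$, \[\log D\big(G(n,p), C^\circlearrowright_{r}\big) = \widetilde{O}\Big(\frac{n}{p}\Big).\]
   Context: $G(n,p)$ is the Erdős–Rényi random graph on $n$ vertices with edge probability $p$. For a graph $G$ and an oriented graph $\vec H$, $D(G,\vec H)$ is the number of orientations of $G$ containing no copy of $\vec H$; $C^\circlearrowright_r$ is the directed cycle of length $r$. $X=\widetilde{O}(g)$ means $X \le g\cdot(\log n)^{C}$ for some constant $C$ (an upper bound up to a polylogarithmic factor). *)

(* Defs.v *)
From mathcomp Require Import all_boot all_order all_algebra.
From mathcomp Require Import all_classical all_reals all_analysis.

Set Implicit Arguments.
Unset Strict Implicit.
Unset Printing Implicit Defensive.

Import Order.TTheory GRing.Theory Num.Theory.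
Import numFieldNormedType.Exports.

Local Open Scope ring_scope.

(* A finite simple graph on the vertex type T is given by its set of edges,
   which are two-element subsets of T; a directed graph by its set of arcs. *)

Definition simple_graph (T : finType) (E : {set {set T}}) : bool :=
  [forall e in E, #|e| == 2%N].

(* The case u = v excludes loops. *)
Definition oriented_graph (T : finType) (A : {set T * T}) : bool :=
  [forall u, forall v, ~~ (((u, v) \in A) && ((v, u) \in A))].

Definition underlying_graph (T : finType) (A : {set T * T}) : {set {set T}} :=
  [set [set a.1; a.2] | a in A].

Definition orientation_of (T : finType) (E : {set {set T}}) (A : {set T * T})
    : bool :=
  oriented_graph A && (underlying_graph A == E).

(* Copies are subgraphs, not necessarily induced. *)
Definition contains_copy (S T : finType) (H : {set S * S}) (A : {set T * T})
    : bool :=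
  [exists f : {ffun S -> T},
    injectiveb f && [forall a in H, (f a.1, f a.2) \in A]].

Definition num_orientations (S T : finType) (E : {set {set T}})
    (H : {set S * S}) : nat :=
  #|[set A : {set T * T} | orientation_of E A && ~~ contains_copy H A]|.

(* ordS i is i + 1 modulo r. *)
Definition dicycle (r : nat) : {set 'I_r * 'I_r} :=
  [set (i, ordS i) | i : 'I_r].

(* The probability that G(n,p) has the property Q. *)
Definition gnp_prob (R : realType) (n : nat) (p : R)
    (Q : pred {set {set 'I_n}}) : R :=
  \sum_(E : {set {set 'I_n}} | simple_graph E && Q E)
    p ^+ #|E| * (1 - p) ^+ ('C(n, 2) - #|E|).

(* Main.v *)
(** Call a graph edge-rich if every vertex set Z with |Z| >= 32 (ln n) / p spans
    at least p |Z| (|Z| - 1) / 8 edges.  Chernoff's inequality and a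
    union bound over Z show that G(n,p) has this property with high
    probability; the rest is deterministic.

    Add the vertices one at a time.  Given an orientation of G[W] without C_r,
    the out-neighbourhood of a new vertex v is a subset of U = N(v) :&: W which
    is closed under directed paths of length r - 2 inside U, since a path of
    that length from an out-neighbour to an in-neighbour closes a cycle through
    v.  If |U| is at least of order (ln n) / p, then edge-richness gives a
    vertex w of U which reaches at least q |U| vertices by such paths and is
    reached by at least q |U| vertices, with q of order p: deleting the vertices
    of low out-degree removes few vertices, so all but few vertices start a long
    path whose last step has many choices, and the same holds for the reversed
    arcs.  Branching on whether w lies in the closed set shrinks U by a factor
    1 - q on either side, so there are only exp (O ((ln n) / p)) closed sets,
    hence as many extensions to v. *)

Require Import Defs.
From mathcomp Require Import all_boot all_order all_algebra.
From mathcomp Require Import all_classical all_reals all_analysis.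
(* Several names of [fintype] and [finset] are hidden by [classical_sets]. *)
From mathcomp Require Import fintype finset zify ring lra.

Set Implicit Arguments.
Unset Strict Implicit.
Unset Printing Implicit Defensive.

Import Order.TTheory GRing.Theory Num.Theory.
Import numFieldNormedType.Exports.

(** * Sets closed under directed paths of a given length *)

Definition outnb (T : finType) (e : rel T) (X : {set T}) (x : T) : {set T} :=
  [set y in X | e x y].

Definition arcs_in (T : finType) (e : rel T) (X : {set T}) : nat :=
  \sum_(x in X) #|outnb e X x|.

(** Vertices are distinct so that closing the path through a vertex outside [U] gives a genuine
    cycle, of length [l.+2]. *)
Definition reach (T : finType) (e : rel T) (l : nat) (U : {set T}) : rel T :=
  fun x y => [exists t : l.-tuple T,
    [&& path e x t, uniq (x :: t), all (mem U) (x :: t) & last x t == y]].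

Definition reach_closed (T : finType) (e : rel T) (l : nat) (U S : {set T}) :=
  (S \subset U)
  && [forall x in S, forall y, reach e l U x y ==> (y \in S)].

Definition num_closed (T : finType) (e : rel T) (l : nat) (U : {set T}) : nat :=
  #|[set S : {set T} | reach_closed e l U S]|.

Lemma arcs_in_rev (T : finType) (e : rel T) (X : {set T}) :
  arcs_in (fun x y => e y x) X = arcs_in e X.
Proof.
have cardE (f : rel T) x : #|outnb f X x| = \sum_(y in X) f x y.
  rewrite -sum1_card big_mkcond [RHS]big_mkcond; apply: eq_bigr => y _.
  by rewrite inE; case: (y \in X) (f x y) => [] [].
rewrite /arcs_in (eq_bigr _ (fun x _ => cardE _ x)).
by rewrite exchange_big; apply: eq_bigr => x _; rewrite cardE.
Qed.

Lemma reachP (T : finType) (e : rel T) (l : nat) (U : {set T}) (x y : T) :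
  reflect (exists s, [/\ size s = l, path e x s, uniq (x :: s),
                         {subset x :: s <= U} & last x s = y])
          (reach e l U x y).
Proof.
apply: (iffP existsP) => [[t /and4P[pt ut /allP at_ /eqP lt]] | [s [ss ps us as_ ls]]].
  by exists t; rewrite size_tuple.
exists (Tuple (introT eqP ss)); apply/and4P; split => //; last exact/eqP.
exact/allP.
Qed.

Lemma reachS (T : finType) (e : rel T) (l : nat) (U V : {set T}) (x y : T) :
  U \subset V -> reach e l U x y -> reach e l V x y.
Proof.
move=> /subsetP UV /reachP[s [ss ps us sU ls]]; apply/reachP; exists s.
by split => // z /sU /UV.
Qed.

Lemma reach_rev (T : finType) (e : rel T) (l : nat) (U : {set T}) (x y : T) :
  reach (fun u v => e v u) l U x y -> reach e l U y x.
Proof.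
move=> /reachP[s [ss ps us sU ls]]; apply/reachP.
have E : rev (x :: s) = y :: rev (belast x s).
  by rewrite lastI rev_rcons ls.
exists (rev (belast x s)); split.
- by rewrite size_rev size_belast.
- by rewrite -ls rev_path.
- by rewrite -E rev_uniq.
- by move=> z; rewrite -E mem_rev; exact: sU.
- by have := congr1 (last x) E; rewrite rev_cons last_rcons.
Qed.

Section Dense.
Variables (T : finType) (e : rel T) (U : {set T}) (m d : nat).
Hypothesis m_gt0 : 0 < m.
Hypothesis dense : forall Z : {set T}, Z \subset U -> m <= #|Z| ->
  d * #|Z| <= arcs_in e Z.

(** The remaining vertices of [X] each have fewer than [d] out-neighbours among themselves, so [m]
    or more of them would violate [dense]. *)
Lemma card_high_outdeg (X : {set T}) : X \subset U ->
  #|X| < #|[set x in X | d <= #|outnb e X x|]| + m.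
Proof.
move=> XU; set L := [set x in X | _].
have LX : L \subset X by apply/subsetP => x; rewrite inE => /andP[].
rewrite -(cardsID L X) (setIidPr LX) ltn_add2l ltnNge.
apply/negP => mB; have := dense (subset_trans (subsetDl _ _) XU) mB.
apply/negP; rewrite -ltnNge /arcs_in.
have : \sum_(x in X :\: L) #|outnb e (X :\: L) x|.+1 <= \sum_(x in X :\: L) d.
  apply: leq_sum => x; rewrite !inE => /andP[xL xX]; move: xL.
  rewrite xX /= -ltnNge; apply: leq_ltn_trans; apply: subset_leq_card.
  by apply/subsetP => y; rewrite !inE => /andP[/andP[_ ->] ->].
rewrite sum_nat_const -(eq_bigr _ (fun x _ => addn1 _)) big_split /= sum1_card.
lia.
Qed.

(** Induction inside the vertices of out-degree at least [d] in [X]: a path found there ends at a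
    vertex with more out-neighbours in [X] than the path has vertices, so it extends. *)
Lemma exists_dipath (k : nat) (X : {set T}) : X \subset U -> k < d ->
  k * m < #|X| ->
  exists x s, [/\ size s = k, path e x s, uniq (x :: s) & {subset x :: s <= X}].
Proof.
elim: k X => [|k IH] X XU kd.
  rewrite mul0n card_gt0 => /set0Pn[x xX]; exists x, [::]; split => //.
  by move=> y; rewrite inE => /eqP->.
move=> kX; set L := [set x in X | d <= #|outnb e X x|].
have LX : L \subset X by apply/subsetP => x; rewrite inE => /andP[].
have [|x [s [ss ps us sL]]] := IH L (subset_trans LX XU) (ltnW kd).
  have := card_high_outdeg XU; rewrite -/L; lia.
have : last x s \in L by apply: sL; apply: mem_last.
rewrite inE => /andP[_ dl].
have /subsetPn[y] : ~~ (outnb e X (last x s) \subset x :: s).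
  apply/negP => /subset_leq_card; apply/negP; rewrite -ltnNge.
  by apply: leq_trans dl; rewrite (card_uniqP us) /= ss.
rewrite !inE => /andP[yX ely] /norP[yx ys].
exists x, (rcons s y); split.
- by rewrite size_rcons ss.
- by rewrite rcons_path ps.
- by rewrite -rcons_cons rcons_uniq inE negb_or yx ys.
- move=> z; rewrite -rcons_cons mem_rcons inE => /predU1P[->//|/sL].
  exact: subsetP LX z.
Qed.

(** Take a path of length [k] among vertices of high out-degree. The out-neighbours of its last
    vertex, except at most [k.+1] on the path, all end a path of length [k.+1]. *)
Lemma exists_reach_many (k : nat) (X : {set T}) : X \subset U -> k < d ->
  k.+1 * m <= #|X| ->
  exists2 x, x \in X & d - k.+1 <= #|[set y | reach e k.+1 U x y]|.
Proof.
move=> XU kd kX; set L := [set x in X | d <= #|outnb e X x|].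
have LX : L \subset X by apply/subsetP => x; rewrite inE => /andP[].
have [|x [s [ss ps us sL]]] := exists_dipath (subset_trans LX XU) kd.
  have := card_high_outdeg XU; rewrite -/L; lia.
exists x; first by apply: (subsetP LX); apply: sL; rewrite mem_head.
have : last x s \in L by apply: sL; apply: mem_last.
rewrite inE => /andP[_ dl].
apply: leq_trans (_ : #|outnb e X (last x s) :\: [set z in x :: s]| <= _).
  rewrite cardsD; apply: leq_sub => //.
  apply: leq_trans (subset_leq_card (subsetIr _ _)) _.
  by rewrite cardsE (card_uniqP us) /= ss.
apply: subset_leq_card; apply/subsetP => y.
rewrite !inE => /andP[/norP[yx ys] /andP[yX ely]].
apply/reachP; exists (rcons s y); split.
- by rewrite size_rcons ss.
- by rewrite rcons_path ps.
- by rewrite -rcons_cons rcons_uniq inE negb_or yx ys.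
- move=> z; rewrite -rcons_cons mem_rcons inE => /predU1P[->|/sL].
    exact: (subsetP XU).
  by move=> /(subsetP LX)/(subsetP XU).
- by rewrite last_rcons.
Qed.

Lemma card_low_reach (k : nat) : k < d ->
  #|[set x in U | #|[set y | reach e k.+1 U x y]| < d - k.+1]| < k.+1 * m.
Proof.
move=> kd; rewrite ltnNge; apply/negP => kX.
have XU : [set x in U | #|[set y | reach e k.+1 U x y]| < d - k.+1] \subset U.
  by apply/subsetP => x; rewrite inE => /andP[].
have [x] := exists_reach_many XU kd kX.
by rewrite inE => /andP[_]; rewrite ltnNge => /negP.
Qed.
End Dense.

(** Reversing arcs preserves [arcs_in], so fewer than [k.+1 * m] vertices fail in each direction,
    and together they cannot cover [U]. *)
Lemma exists_pivot (T : finType) (e : rel T) (U : {set T}) (m d k : nat) :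
  0 < m -> k < d -> (k.+1 * m).*2 <= #|U| ->
  (forall Z : {set T}, Z \subset U -> m <= #|Z| -> d * #|Z| <= arcs_in e Z) ->
  exists x, d - k.+1 <= #|[set y | reach e k.+1 U x y]| /\
            d - k.+1 <= #|[set y | reach e k.+1 U y x]|.
Proof.
move=> m0 kd kU dense.
pose X := [set x in U | #|[set y | reach e k.+1 U x y]| < d - k.+1].
pose e' : rel T := fun x y => e y x.
pose Y := [set x in U | #|[set y | reach e' k.+1 U x y]| < d - k.+1].
have Xs : #|X| < k.+1 * m by apply: card_low_reach.
have Ys : #|Y| < k.+1 * m.
  by apply: card_low_reach => // Z ZU mZ; rewrite arcs_in_rev dense.
have /subsetPn[x xU] : ~~ (U \subset X :|: Y).
  apply/negP => /subset_leq_card; have [+ _] := leq_card_setU X Y; lia.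
rewrite /X /Y !inE xU /= negb_or -!leqNgt => /andP[hX hY]; exists x; split => //.
apply: leq_trans hY _; apply: subset_leq_card; apply/subsetP => y.
by rewrite !inE; exact: reach_rev.
Qed.

Lemma num_closed_le_exp (T : finType) (e : rel T) (l : nat) (U : {set T}) :
  num_closed e l U <= 2 ^ #|U|.
Proof.
rewrite -card_powerset; apply: subset_leq_card; apply/subsetP => S.
by rewrite !inE => /andP[].
Qed.

Lemma reach_closedI (T : finType) (e : rel T) (l : nat) (U V S : {set T}) :
  V \subset U -> reach_closed e l U S -> reach_closed e l V (S :&: V).
Proof.
move=> VU /andP[_ /forall_inP clS]; rewrite /reach_closed subsetIr /=.
apply/forall_inP => x; rewrite inE => /andP[xS xV].
apply/forallP => y; apply/implyP => rxy.
have /reachP[s [_ _ _ sV sy]] := rxy.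
have /forallP/(_ y)/implyP := clS x xS.
move=> /(_ (reachS VU rxy)) yS.
by rewrite inE yS -sy sV // mem_last.
Qed.

(* A closed set contains everything reachable from w if it contains w, and
   nothing from which w is reachable if it does not. *)
Lemma num_closed_branch (T : finType) (e : rel T) (l : nat) (U : {set T})
    (w : T) :
  num_closed e l U <= num_closed e l (U :\: [set y | reach e l U w y])
                      + num_closed e l (U :\: [set y | reach e l U y w]).
Proof.
set V1 := U :\: _; set V2 := U :\: _.
pose C := [set S : {set T} | reach_closed e l U S].
pose C1 := [set S in C | w \in S].
have -> : num_closed e l U = #|C1| + #|C :\: C1|.
  rewrite /num_closed -[LHS](cardsID C1) (setIidPr _) //.
  by apply/subsetP => S; rewrite /C1 [_ \in [set _ in _ | _]]inE => /andP[].
apply: leq_add.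
  (* Members of [C1] share all that [w] reaches, so their trace on [V1] determines them. *)
  rewrite -(@card_in_imset _ _ (fun S : {set T} => S :&: V1) (mem C1)); last first.
    have aux (S1 S2 : {set T}) : S1 \in C1 -> S2 \in C1 -> S1 :&: V1 = S2 :&: V1 ->
        S1 \subset S2.
      rewrite /C1 /C !inE => /andP[/andP[S1U _] _] /andP[/andP[_ /forall_inP c2] w2] E.
      apply/subsetP => y y1; have yU := subsetP S1U _ y1.
      case: (boolP (reach e l U w y)) => rwy.
        by have /forallP/(_ y)/implyP/(_ rwy) := c2 w w2.
      have : y \in S1 :&: V1 by rewrite !inE y1 rwy yU.
      by rewrite E inE => /andP[].
    move=> S1 S2 h1 h2 E; apply/eqP; rewrite eqEsubset.
    by rewrite (aux _ _ h1 h2 E) (aux _ _ h2 h1 (esym E)).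
  apply: subset_leq_card; apply/subsetP => _ /imsetP[S + ->].
  rewrite /C1 /C !inE => /andP[cS _]; apply: reach_closedI cS; exact: subsetDl.
apply: subset_leq_card; apply/subsetP => S; rewrite /C1 /C !inE.
move=> /andP[+ cS]; rewrite cS /= => wS.
have /andP[SU /forall_inP cl] := cS.
suff SV : S \subset V2.
  by rewrite -(setIidPl SV); apply: reach_closedI cS; exact: subsetDl.
apply/subsetP => y yS; rewrite !inE (subsetP SU) // andbT.
by apply/negP => ryw; have /forallP/(_ w)/implyP/(_ ryw) := cl y yS; apply/negP.
Qed.

(** * Extending an orientation by one vertex *)

Definition edges_in (T : finType) (E : {set {set T}}) (W : {set T}) :
    {set {set T}} :=
  [set f in E | f \subset W].

Definition arc_rel (T : finType) (A : {set T * T}) : rel T :=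
  fun x y => (x, y) \in A.

Definition arcs_within (T : finType) (A : {set T * T}) (W : {set T}) :
    {set T * T} :=
  [set a in A | (a.1 \in W) && (a.2 \in W)].

Definition free_orientations (T : finType) (r : nat) (E : {set {set T}})
    (W : {set T}) : {set {set T * T}} :=
  [set A | orientation_of (edges_in E W) A && ~~ contains_copy (dicycle r) A].

(** Converts edge-richness into the arc density that [exists_pivot] asks for, whatever the
    orientation. *)
Lemma card_edges_in_le (T : finType) (E : {set {set T}}) (W Z : {set T})
    (A : {set T * T}) :
  orientation_of (edges_in E W) A -> Z \subset W ->
  #|edges_in E Z| <= arcs_in (arc_rel A) Z.
Proof.
move=> /andP[_ /eqP undA] ZW.
have -> : arcs_in (arc_rel A) Z = #|arcs_within A Z|.
  rewrite -sum1_card /arcs_in.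
  rewrite (eq_bigr (fun x => \sum_(y in outnb (arc_rel A) Z x) 1)); last first.
    by move=> x _; rewrite sum1_card.
  rewrite pair_big_dep /=; apply: eq_bigl => -[x y].
  by rewrite !inE /arc_rel /=; case: (_ \in Z) (_ \in Z) (_ \in A) => [] [] [].
apply: leq_trans (leq_imset_card (fun a => [set a.1; a.2]) _).
apply: subset_leq_card; apply/subsetP => f; rewrite inE => /andP[fE fZ].
have : f \in underlying_graph A by rewrite undA inE fE (subset_trans fZ).
move=> /imsetP[a aA fa]; apply/imsetP; exists a => //.
by rewrite inE aA; move: fZ; rewrite fa subUset !sub1set.
Qed.

Lemma contains_copyS (S T : finType) (H : {set S * S}) (A B : {set T * T}) :
  A \subset B -> contains_copy H A -> contains_copy H B.
Proof.
move=> /subsetP AB /existsP[f /andP[fi /forall_inP fA]].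
apply/existsP; exists f; rewrite fi; apply/forall_inP => a aH.
by apply/AB/fA.
Qed.

Lemma contains_dicycle (T : finType) (A : {set T * T}) (v : T) (s : seq T) :
  path (arc_rel A) v s -> uniq (v :: s) -> arc_rel A (last v s) v ->
  contains_copy (dicycle (size s).+1) A.
Proof.
move=> ps us lv; apply/existsP.
exists [ffun i : 'I_(size s).+1 => nth v (v :: s) i]; apply/andP; split.
  apply/injectiveP => i j; rewrite !ffunE => /eqP.
  by rewrite nth_uniq //; move=> /eqP/val_inj.
apply/forall_inP => _ /imsetP[i _ ->]; rewrite !ffunE /=.
(* The last index wraps around to 0: this is the closing arc. *)
have := ltn_ord i; rewrite ltnS leq_eqVlt => /orP[/eqP ->|lti].
  by rewrite modnn -last_nth.
by rewrite modn_small ?ltnS //; move/pathP: ps => /(_ v i lti).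
Qed.

Lemma arcs_within_free (T : finType) (r : nat) (E : {set {set T}})
    (V W : {set T}) (A : {set T * T}) :
  W \subset V -> A \in free_orientations r E V ->
  arcs_within A W \in free_orientations r E W.
Proof.
move=> WV; rewrite !inE => /andP[/andP[oA /eqP uA] cA].
have AW : arcs_within A W \subset A by apply/subsetP => a; rewrite inE => /andP[].
apply/andP; split; last by apply: contra cA; apply: contains_copyS.
apply/andP; split.
  apply/forallP => x; apply/forallP => y; move/forallP/(_ x)/forallP/(_ y): oA.
  by apply: contra => /andP[/(subsetP AW) -> /(subsetP AW) ->].
apply/eqP/setP => f; apply/imsetP/idP => [[a] | ].
  rewrite inE => /andP[aA /andP[a1 a2]] ->.
  have : [set a.1; a.2] \in underlying_graph A by apply/imsetP; exists a.
  by rewrite uA !inE => /andP[-> _]; rewrite subUset !sub1set a1.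
rewrite inE => /andP[fE fW].
have : f \in underlying_graph A by rewrite uA inE fE (subset_trans fW).
move=> /imsetP[a aA fa]; exists a => //.
by rewrite inE aA; move: fW; rewrite fa subUset !sub1set.
Qed.

(* The out-neighbourhood of v is closed under directed paths of length r - 2
   between neighbours of v, as such a path leaving it would close a cycle. *)
Lemma outnb_closed (T : finType) (l : nat) (E : {set {set T}}) (W : {set T})
    (v : T) (A : {set T * T}) : v \notin W ->
  A \in free_orientations l.+2 E (v |: W) ->
  reach_closed (arc_rel (arcs_within A W)) l [set x in W | [set v; x] \in E]
    (outnb (arc_rel A) W v).
Proof.
move=> vW; rewrite inE => /andP[/andP[oA /eqP uA] cA].
have inE_arc x y : arc_rel A x y -> [set x; y] \in edges_in E (v |: W).
  by move=> xy; rewrite -uA; apply/imsetP; exists (x, y).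
apply/andP; split.
  apply/subsetP => x; rewrite !inE => /andP[-> /inE_arc].
  by rewrite inE => /andP[].
apply/forall_inP => x; rewrite inE => /andP[xW vx].
apply/forallP => y; apply/implyP => /reachP[s [ss ps us sU ls]].
have sW z : z \in x :: s -> z \in W by move=> /sU; rewrite inE => /andP[].
have yU := sU y; rewrite -ls mem_last ls in yU.
have {yU} := yU isT; rewrite inE => /andP[yW vy].
rewrite inE yW /=; apply: contraNT cA => vyA.
(* The edge between [v] and [y] is oriented somehow, and not away from [v]. *)
have yv : arc_rel A y v.
  have : [set v; y] \in underlying_graph A.
    by rewrite uA inE vy subUset !sub1set !inE eqxx yW orbT.
  move=> /imsetP[[a b] abA] /= /setP Eab.
  have := Eab v; have := Eab y; rewrite !inE !eqxx orbT /=.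
  have vNy : v != y by apply: contraNneq vW => ->.
  move=> /esym/orP[]/eqP ya /esym/orP[]/eqP va; rewrite /arc_rel ?ya ?va //.
  - by rewrite ya va eqxx in vNy.
  - by move: vyA; rewrite /arc_rel ya va abA.
  - by rewrite ya va eqxx in vNy.
have -> : l.+2 = (size (x :: s)).+1 by rewrite /= ss.
apply: contains_dicycle (v) _ _ _ _ => /=.
- rewrite vx; apply: sub_path ps => a b; rewrite /arc_rel inE => /andP[]//.
- by apply/andP; split => //; apply/negP => /sW; exact/negP.
- by rewrite ls.
Qed.

(** Arcs inside [W] are shared, arcs leaving [v] are recorded by its out-neighbourhood, and all
    other edges at [v] must point to [v]. Equality follows by symmetry. *)
Lemma orientation_determined (T : finType) (r : nat) (E : {set {set T}})
    (W : {set T}) (v : T) (A B : {set T * T}) : v \notin W ->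
  A \in free_orientations r E (v |: W) ->
  B \in free_orientations r E (v |: W) ->
  arcs_within A W = arcs_within B W -> outnb (arc_rel A) W v = outnb (arc_rel B) W v ->
  A \subset B.
Proof.
move=> vW; rewrite !inE => /andP[/andP[oA /eqP uA] _] /andP[/andP[oB /eqP uB] _].
move=> eqW eqv; apply/subsetP => -[x y] xyA.
have fA : [set x; y] \in underlying_graph A by apply/imsetP; exists (x, y).
have xNy : x != y.
  apply/eqP => xy; move/forallP/(_ x)/forallP/(_ x): oA.
  by rewrite {2 4}xy xyA.
have := fA; rewrite uA inE subUset !sub1set => /andP[_ /andP[]].
rewrite !in_setU1 => /predU1P[xv|xW] /predU1P[yv|yW].
- by rewrite xv yv eqxx in xNy.
- by have := in_setT y; move/setP/(_ y): eqv; rewrite !inE yW /arc_rel -xv xyA.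
- have xNS : x \notin outnb (arc_rel B) W v.
    rewrite -eqv inE xW /= /arc_rel -yv; move/forallP/(_ x)/forallP/(_ y): oA.
    by rewrite xyA.
  have : [set x; y] \in underlying_graph B by rewrite uB -uA.
  move=> /imsetP[[a b] abB] /= /setP Eab.
  have := Eab x; have := Eab y; rewrite !inE !eqxx orbT /=.
  move=> /esym/orP[]/eqP ya /esym/orP[]/eqP xa.
  + by rewrite ya xa eqxx in xNy.
  + by move: xNS; rewrite inE xW /arc_rel -yv ya xa abB.
  + by rewrite xa ya.
  + by rewrite ya xa eqxx in xNy.
- have : (x, y) \in arcs_within A W by rewrite inE xyA xW.
  by rewrite eqW inE => /andP[].
Qed.

(** Group the orientations by their restriction [B] to [W]. Within a group the out-neighbourhood of
    [v] determines the orientation and is a closed set for [B], so a group has at most [M]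
    members. *)
Lemma card_free_orientationsU1 (T : finType) (l M : nat) (E : {set {set T}})
    (W : {set T}) (v : T) : v \notin W ->
  (forall (B : {set T * T}) (U : {set T}), B \in free_orientations l.+2 E W ->
     U \subset W -> num_closed (arc_rel B) l U <= M) ->
  #|free_orientations l.+2 E (v |: W)| <= M * #|free_orientations l.+2 E W|.
Proof.
move=> vW hM.
have WV : W \subset v |: W by apply: subsetUr.
rewrite -sum1_card (partition_big (fun A => arcs_within A W)
  (mem (free_orientations l.+2 E W))) /=; last first.
  by move=> A; apply: arcs_within_free.
rewrite mulnC -sum_nat_const; apply: leq_sum => B BW.
have UW : [set x in W | [set v; x] \in E] \subset W.
  by apply/subsetP => x; rewrite inE => /andP[].
apply: leq_trans (hM B _ BW UW).
set O := free_orientations _ _ _.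
have -> : \sum_(A in O | arcs_within A W == B) 1
    = #|[set A in O | arcs_within A W == B]|.
  by rewrite -sum1_card; apply: eq_bigl => A; rewrite inE.
rewrite -(@card_in_imset _ _ (fun A => outnb (arc_rel A) W v)); last first.
  move=> A1 A2 /setIdP[h1 /eqP e1] /setIdP[h2 /eqP e2] E12.
  have e12 : arcs_within A1 W = arcs_within A2 W by rewrite e1 e2.
  apply/eqP; rewrite eqEsubset (orientation_determined vW h1 h2) //.
  exact: (orientation_determined vW h2 h1).
apply: subset_leq_card; apply/subsetP => _ /imsetP[A + ->].
move=> /setIdP[AO /eqP <-]; rewrite inE.
exact: outnb_closed.
Qed.

Lemma card_free_orientations_le (T : finType) (l M : nat) (E : {set {set T}})
    (W : {set T}) :
  (forall (B : {set T * T}) (V U : {set T}), B \in free_orientations l.+2 E V ->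
     U \subset V -> num_closed (arc_rel B) l U <= M) ->
  #|free_orientations l.+2 E W| <= M ^ #|W|.
Proof.
move=> hM; elim: {W}#|W| {-2}W (erefl #|W|) => [|k IH] W cW.
  rewrite cW expn0 -(cards1 (set0 : {set T * T})); apply: subset_leq_card.
  move/eqP: cW; rewrite cards_eq0 => /eqP ->.
  apply/subsetP => A; rewrite !inE => /andP[/andP[_ /eqP uA] _].
  rewrite -subset0; apply/subsetP => a aA.
  have : [set a.1; a.2] \in underlying_graph A by apply/imsetP; exists a.
  by rewrite uA inE subset0 => /andP[_ /eqP/setP/(_ a.1)]; rewrite !inE eqxx.
have /set0Pn[v vW] : W != set0 by rewrite -card_gt0 cW.
rewrite cW expnS -{1}(setD1K vW).
have cW' : #|W :\ v| = k by have := cardsD1 v W; rewrite vW cW => -[].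
apply: leq_trans (card_free_orientationsU1 _ _) _; first by rewrite !inE eqxx.
  by move=> B U BW UW; apply: hM BW UW.
by have := IH _ cW'; rewrite cW' leq_mul2l => ->; rewrite orbT.
Qed.

Lemma num_orientationsE (T : finType) (r : nat) (E : {set {set T}}) :
  num_orientations E (dicycle r) = #|free_orientations r E [set: T]|.
Proof.
rewrite /num_orientations /free_orientations.
suff -> : edges_in E [set: T] = E by [].
by apply/setP => f; rewrite inE subsetT andbT.
Qed.

(** * Counting closed sets and orientations under a density condition *)

Local Open Scope ring_scope.

(** Both branches at a pivot shrink the set by a factor [1 - q]. After [j] levels there are at most
    [2 ^ j] sets of size at most [K], each with at most [2 ^ K] closed subsets. *)
Lemma num_closed_le (R : realFieldType) (q : R) (T : finType) (e : rel T)
    (l K : nat) (W : {set T}) : 0 <= q <= 1 ->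
  (forall U : {set T}, U \subset W -> (K <= #|U|)%N ->
     exists x, q * #|U|%:R <= #|[set y | reach e l U x y]|%:R /\
               q * #|U|%:R <= #|[set y | reach e l U y x]|%:R) ->
  forall j (U : {set T}), U \subset W -> #|U|%:R * (1 - q) ^+ j <= K%:R ->
  (num_closed e l U <= 2 ^ (K + j))%N.
Proof.
move=> q01 piv; elim=> [|j IH] U UW.
  rewrite mulr1 ler_nat addn0 => UK.
  by apply: leq_trans (num_closed_le_exp _ _ _) _; rewrite leq_exp2l.
have [UK _|UK Uj] := leqP #|U| K.
  apply: leq_trans (num_closed_le_exp _ _ _) _; rewrite leq_exp2l //.
  exact: leq_trans UK (leq_addr _ _).
have [x [hout hin]] := piv U UW (ltnW UK).
have aux (V : {set T}) : V \subset U -> q * #|U|%:R <= #|V|%:R ->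
    (num_closed e l (U :\: V) <= 2 ^ (K + j))%N.
  move=> VU qV; apply: IH; first exact: subset_trans (subsetDl _ _) UW.
  apply: le_trans Uj; rewrite exprS mulrA ler_wpM2r //.
    by rewrite exprn_ge0 // subr_ge0; case/andP: q01.
  rewrite cardsD (setIidPr VU) natrB ?subset_leq_card //.
  by rewrite mulrBr mulr1 lerD2l lerN2 mulrC.
apply: leq_trans (num_closed_branch e l U x) _.
rewrite addnS expnS mul2n -addnn leq_add // aux //; apply/subsetP => y.
  by rewrite inE => /reachP[s [_ _ _ sU <-]]; rewrite sU // mem_last.
by rewrite inE => /reachP[s [_ _ _ sU _]]; rewrite sU // mem_head.
Qed.

Lemma num_orientations_le (R : archiRealFieldType) (c k0 : R) (T : finType)
    (E : {set {set T}}) (k K j : nat) : 0 < c <= 1 ->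
  (forall Z : {set T}, k0 <= #|Z|%:R ->
     c * #|Z|%:R ^+ 2 <= #|edges_in E Z|%:R) ->
  4 * k.+1%:R <= K%:R :> R -> 4 * k.+1%:R * k0 <= K%:R ->
  8 * k.+1%:R * k.+2%:R <= c * K%:R ->
  #|T|%:R * (1 - c / (8 * k.+1%:R)) ^+ j <= K%:R ->
  (num_orientations E (dicycle k.+3) <= 2 ^ ((K + j) * #|T|))%N.
Proof.
move=> /andP[c0 c1] dense K1 K2 K3 Kj.
rewrite num_orientationsE -cardsT expnM; apply: card_free_orientations_le.
move=> B V U0; rewrite inE => /andP[oB _] U0V.
have l0 : 1 <= k.+1%:R :> R by rewrite ler1n.
set q := c / (8 * k.+1%:R) in Kj *.
have q0 : 0 <= q by rewrite divr_ge0 //; lra.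
have q1 : q <= 1 by rewrite ler_pdivrMr; lra.
apply: (@num_closed_le R q T _ _ K V) => //; first by rewrite q0 q1.
  move=> U UV KU.
  have KU' : K%:R <= #|U|%:R :> R by rewrite ler_nat.
  set u : R := #|U|%:R in KU' *.
  (* The largest [m] that [exists_pivot] admits; rounding down costs at most a factor 2 because
     [4 * k.+1 <= K <= #|U|]. *)
  pose m := (#|U| %/ (2 * k.+1))%N.
  have mU : (m * (2 * k.+1) <= #|U|)%N by apply: leq_trunc_div.
  have Um : u < (m%:R + 1) * (2 * k.+1%:R).
    by rewrite /u natr1 -!natrM ltr_nat ltn_ceil.
  have um : u <= 4 * k.+1%:R * m%:R by lra.
  have m0 : (0 < m)%N.
    rewrite -(ltr_nat R); have : 0 < 4 * k.+1%:R :> R by lra.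
    by move=> /pmulr_rgt0 <-; lra.
  have k0m : k0 <= m%:R.
    have : 4 * k.+1%:R * k0 <= 4 * k.+1%:R * m%:R by lra.
    by rewrite ler_pM2l //; lra.
  pose d := Num.trunc (c * m%:R).
  have cm0 : 0 <= c * m%:R by rewrite mulr_ge0 ?ler0n // ltW.
  have /andP[dle dgt] := truncn_itv cm0; rewrite -/d in dle dgt.
  have qu : q * u * (8 * k.+1%:R) = c * u by rewrite /q; field; lra.
  (* [c * m] is at least twice [q * u]; the second copy is at least [k.+2], which pays for [k.+1]
     and for the truncation in [d]. *)
  have Dq : q * u + k.+1%:R <= d%:R.
    rewrite -natr1 in dgt.
    have cu : c * u <= c * (4 * k.+1%:R * m%:R) by rewrite ler_pM2l.
    have cK : c * K%:R <= c * u by rewrite ler_pM2l.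
    have l8 : 0 < 8 * k.+1%:R :> R by lra.
    have h1 : 2 * (q * u) <= c * m%:R.
      by rewrite -(ler_pM2l l8); lra.
    have h2 : k.+2%:R <= q * u.
      by rewrite -(ler_pM2l l8); lra.
    rewrite -[k.+2%:R]natr1 in h2.
    lra.
  have qu0 : 0 <= q * u by rewrite mulr_ge0 // ler0n.
  have kd : (k < d)%N by rewrite -(ler_nat R); lra.
  have [||x [h1 h2]] := @exists_pivot _ (arc_rel B) U m d k m0 kd.
  - by rewrite -mul2n mulnA mulnC.
  - move=> Z ZU mZ; apply: leq_trans (card_edges_in_le oB (subset_trans ZU UV)).
    have mZ' : m%:R <= #|Z|%:R :> R by rewrite ler_nat.
    have := dense Z (le_trans k0m mZ'); rewrite -(ler_nat R) natrM.
    apply: le_trans; rewrite expr2 mulrA ler_wpM2r ?ler0n //.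
    by apply: le_trans dle _; rewrite ler_pM2l.
  have Ddk : q * u <= (d - k.+1)%N%:R by rewrite natrB //; lra.
  by exists x; split; apply: le_trans Ddk _; rewrite ler_nat.
apply: le_trans Kj; rewrite ler_wpM2r ?ler_nat ?max_card //.
by rewrite exprn_ge0 // subr_ge0.
Qed.

(** * Edge-richness of the random graph *)

Lemma sum_expr_cards (R : comNzRingType) (I : finType) (t : R) :
  \sum_(J : {set I}) t ^+ #|J| = (1 + t) ^+ #|I|.
Proof.
transitivity (\prod_(i : I) (t + 1)); last by rewrite prodr_const addrC.
rewrite (@bigA_distr _ _ _ _ _ _ (fun=> t) (fun=> 1)).
by apply: eq_bigr => J _; rewrite -big_mkcond /= prodr_const.
Qed.

(** Expand the product of [F i + G i]: [F] vanishes off [P], which restricts the sum to subsets of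
    [P], and elements of [P] outside [Q] contribute [p + (1 - p) = 1]. *)
Lemma sum_binomial_subset (R : comNzRingType) (I : finType) (P Q : {set I})
    (p y : R) : Q \subset P ->
  \sum_(E : {set I} | E \subset P)
    p ^+ #|E| * (1 - p) ^+ (#|P| - #|E|) * y ^+ #|E :&: Q|
  = (1 - p + p * y) ^+ #|Q|.
Proof.
move=> QP.
pose F i := (if i \in P then p else 0) * (if i \in Q then y else 1).
pose G i := if i \in P then 1 - p else 1.
transitivity (\prod_i (F i + G i)); last first.
  rewrite -prodr_const [RHS]big_mkcond; apply: eq_bigr => i _; rewrite /F /G.
  have := subsetP QP i; case: (i \in Q) => [/(_ isT) ->|_]; first by rewrite addrC.
  by case: (i \in P); rewrite mulr1 ?add0r // addrC subrK.
rewrite (@bigA_distr _ _ _ _ _ _ F G) big_mkcond; apply: eq_bigr => J _.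
case: ifPn => [JP|/subsetPn[i iJ iP]]; last first.
  by rewrite (bigD1 i) //= iJ /F (negbTE iP) !mul0r.
rewrite -(setIidPr JP) -cardsD (setIidPr JP) -!prodr_const.
rewrite (big_mkcond (mem J)) (big_mkcond (mem (P :\: J))).
rewrite (big_mkcond (mem (J :&: Q))) -!big_split /=.
apply: eq_bigr => i _; rewrite !inE /F /G; have := subsetP JP i.
case: (i \in J) => [/(_ isT) ->|_] /=; first by case: (i \in Q); rewrite ?mulr1.
by rewrite mul1r mulr1.
Qed.

Definition pairs (T : finType) : {set {set T}} := [set f : {set T} | #|f| == 2%N].

Lemma simple_graphE (T : finType) (E : {set {set T}}) :
  simple_graph E = (E \subset pairs T).
Proof.
apply/forall_inP/subsetP => h f /h; first by rewrite inE.
by rewrite inE.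
Qed.

Lemma card_pairs (n : nat) : #|pairs 'I_n| = 'C(n, 2).
Proof. by rewrite /pairs card_draws card_ord. Qed.

Lemma card_pairs_in (T : finType) (X : {set T}) :
  #|edges_in (pairs T) X| = 'C(#|X|, 2).
Proof.
rewrite -cards_draws; apply: eq_card => f.
by rewrite !inE andbC.
Qed.

Definition gnp_weight (R : pzRingType) (n : nat) (p : R) (E : {set {set 'I_n}}) :=
  p ^+ #|E| * (1 - p) ^+ ('C(n, 2) - #|E|).

Lemma gnp_weight_ge0 (R : realType) (n : nat) (p : R) (E : {set {set 'I_n}}) :
  0 < p <= 1 -> 0 <= gnp_weight p E.
Proof.
by move=> /andP[p0 p1]; rewrite mulr_ge0 ?exprn_ge0 ?subr_ge0 // ltW.
Qed.

(** The probability generating function of a binomial variable with ['C(#|X|, 2)] trials. *)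
Lemma gnp_edges_mgf (R : realType) (n : nat) (p y : R) (X : {set 'I_n}) :
  \sum_(E : {set {set 'I_n}} | simple_graph E)
     gnp_weight p E * y ^+ #|edges_in E X|
  = (1 - p + p * y) ^+ 'C(#|X|, 2).
Proof.
have sub : edges_in (pairs _) X \subset pairs 'I_n.
  by apply/subsetP => f; rewrite inE => /andP[].
rewrite -card_pairs_in -(sum_binomial_subset p y sub) card_pairs.
apply: eq_big => [E|E EP]; first by rewrite simple_graphE.
rewrite simple_graphE in EP; congr (_ * y ^+ _); apply: eq_card => f; rewrite !inE.
by case: (boolP (f \in E)) => //= /(subsetP EP); rewrite inE => ->.
Qed.

Lemma gnp_weight_sum (R : realType) (n : nat) (p : R) :
  \sum_(E : {set {set 'I_n}} | simple_graph E) gnp_weight p E = 1.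
Proof.
have := gnp_edges_mgf p 1 (set0 : {set 'I_n}); rewrite mulr1 subrK expr1n => <-.
by apply: eq_bigr => E _; rewrite expr1n mulr1.
Qed.

Lemma gnp_prob_le1 (R : realType) (n : nat) (p : R)
    (Q : pred {set {set 'I_n}}) : 0 < p <= 1 -> gnp_prob p Q <= 1.
Proof.
move=> p01; rewrite -(gnp_weight_sum n p) [leRHS](bigID Q) /= lerDl.
by apply: sumr_ge0 => E _; apply: gnp_weight_ge0.
Qed.

(** Evaluate the generating function at [expR (-1) <= 1 / 2]: each pair contributes at most
    [1 - p / 2 <= expR (- (p / 2))], and half of this decay cancels the prefactor. *)
Lemma gnp_chernoff (R : realType) (n : nat) (p : R) (X : {set 'I_n}) :
  0 < p <= 1 ->
  \sum_(E : {set {set 'I_n}} | simple_graph E)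
    gnp_weight p E * expR (p * 'C(#|X|, 2)%:R / 4 - #|edges_in E X|%:R)
  <= expR (- (p * 'C(#|X|, 2)%:R / 4)).
Proof.
move=> /andP[p0 p1]; set N := 'C(_, _).
have e2 : expR (-1) <= 1 / 2 :> R.
  rewrite expRN div1r lef_pV2 ?posrE ?expR_gt0 //.
  by have := expR_ge1Dx (1 : R); lra.
rewrite (eq_bigr (fun E => expR (p * N%:R / 4) *
    (gnp_weight p E * expR (-1) ^+ #|edges_in E X|))); last first.
  by move=> E _; rewrite expRD -expRM_natr mulN1r; ring.
rewrite -mulr_sumr gnp_edges_mgf -/N.
apply: le_trans (_ : expR (p * N%:R / 4) * expR (- (p / 2)) ^+ N <= _).
  rewrite ler_pM2l ?expR_gt0 // lerXn2r ?nnegrE ?expR_ge0 //.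
    by rewrite addr_ge0 ?subr_ge0 // mulr_ge0 ?expR_ge0 // ltW.
  have pe : p * expR (-1) <= p * (1 / 2) by rewrite ler_pM2l.
  by apply: le_trans (expR_ge1Dx (- (p / 2))); lra.
by rewrite -expRM_natr -expRD ler_expR; lra.
Qed.

(** Union bound through exponential moments: if [Q] fails, some [X] in [D] spans too few edges, and
    then [t E X] is at least 1. *)
Lemma gnp_prob_ge (R : realType) (n : nat) (p : R) (D : pred {set 'I_n})
    (Q : pred {set {set 'I_n}}) : 0 < p <= 1 ->
  (forall E, simple_graph E ->
     (forall X, D X -> p * 'C(#|X|, 2)%:R / 4 <= #|edges_in E X|%:R) -> Q E) ->
  1 - \sum_(X | D X) expR (- (p * 'C(#|X|, 2)%:R / 4)) <= gnp_prob p Q.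
Proof.
move=> p01 hQ; rewrite lerBlDr -[leLHS](gnp_weight_sum n p) [leLHS](bigID Q) /= lerD2l.
pose t (E : {set {set 'I_n}}) (X : {set 'I_n}) : R :=
  expR (p * 'C(#|X|, 2)%:R / 4 - #|edges_in E X|%:R).
apply: le_trans (_ : \sum_(X | D X) \sum_(E | simple_graph E)
    gnp_weight p E * t E X <= _); last first.
  by apply: ler_sum => X _; apply: gnp_chernoff.
rewrite exchange_big [leRHS](bigID Q) /= -[leLHS]add0r lerD //.
  apply: sumr_ge0 => E _; apply: sumr_ge0 => X _.
  by rewrite mulr_ge0 ?expR_ge0 ?gnp_weight_ge0.
apply: ler_sum => E /andP[sE nQ].
have [X DX hX] : exists2 X, D X & #|edges_in E X|%:R < p * 'C(#|X|, 2)%:R / 4.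
  apply: contrapT => h; move/negP: nQ; apply; apply: hQ => // X DX.
  by rewrite leNgt; apply/negP => ?; apply: h; exists X.
rewrite -mulr_sumr ler_peMr ?gnp_weight_ge0 // (bigD1 X) //=.
rewrite -[1]addr0 lerD ?sumr_ge0 // => [|Y _]; last exact: expR_ge0.
by rewrite -[1]expR0 ler_expR subr_ge0 ltW.
Qed.

Lemma bin2_ge (R : realFieldType) (x : nat) : (2 <= x)%N ->
  x%:R ^+ 2 / 4 <= 'C(x, 2)%:R :> R.
Proof.
case: x => [//|y] y1.
have := mul_bin_diag y.+1 1; rewrite bin1 /= => /(congr1 (fun k => k%:R : R)).
rewrite !natrM => E.
have y1' : 1 <= y%:R :> R by rewrite ler1n.
have h : 0 <= y.+1%:R * (y%:R - 1) :> R by rewrite mulr_ge0 // subr_ge0.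
rewrite expr2 -{2}[y.+1%:R]natr1; lra.
Qed.

(** The size condition makes each exponent at least [2 * #|X| * ln n], so a term is at most
    [n ^ (-2 * #|X|)]; over nonempty [X] these sum to [(1 + n ^ (-2)) ^ n - 1]. *)
Lemma sum_dense_failure_le (R : realType) (n : nat) (p : R)
    (D : pred {set 'I_n}) : 0 < p <= 1 -> 1 <= ln n%:R :> R ->
  (forall X, D X -> 32 * ln n%:R / p <= #|X|%:R) ->
  \sum_(X | D X) expR (- (p * 'C(#|X|, 2)%:R / 4)) <= expR n%:R^-1 - 1.
Proof.
move=> /andP[p0 p1] ln1 hD.
have n0 : 0 < n%:R :> R.
  by rewrite ltNge; apply/negP => /ln0 h; rewrite h in ln1; lra.
set t : R := n%:R ^- 2.
have t0 : 0 <= t by rewrite invr_ge0 exprn_ge0 // ltW.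
apply: le_trans (_ : \sum_(X : {set 'I_n} | X != finset.set0) t ^+ #|X| <= _).
  rewrite big_mkcond [leRHS]big_mkcond; apply: ler_sum => X _.
  case: ifPn => [DX|_]; last by case: ifP; rewrite ?exprn_ge0.
  have := hD X DX; rewrite ler_pdivrMr // => hX.
  have X0 : 0 <= #|X|%:R :> R by [].
  have X32 : 32 <= #|X|%:R :> R.
    have : 0 <= #|X|%:R * (1 - p) by rewrite mulr_ge0 // subr_ge0.
    lra.
  rewrite ifT; last by rewrite -card_gt0 -(ltr_nat R); lra.
  have X2 : (2 <= #|X|)%N by rewrite -(ler_nat R); lra.
  have -> : t = expR (- (2 * ln n%:R)).
    by rewrite expRN mulrC expRM_natr lnK.
  rewrite -expRM_natr ler_expR mulNr lerN2.
  have h1 : p * (#|X|%:R ^+ 2 / 4) <= p * 'C(#|X|, 2)%:R.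
    by rewrite ler_pM2l // bin2_ge.
  have h2 : #|X|%:R * (32 * ln n%:R) <= #|X|%:R * (#|X|%:R * p).
    by rewrite ler_wpM2l.
  lra.
have := sum_expr_cards 'I_n t; rewrite (bigD1 finset.set0) //= cards0 expr0 card_ord.
move=> /(canRL (addKr _)) ->; rewrite addrC lerD2r.
have -> : expR n%:R^-1 = expR t ^+ n.
  rewrite -expRM_natr; congr expR; rewrite /t; field.
  by rewrite gt_eqF.
by rewrite lerXn2r ?nnegrE ?expR_ge0 ?expR_ge1Dx // addr_ge0.
Qed.

(** * The bound for edge-rich graphs, and the limit *)

Lemma ln_num_orientations_le (R : realType) (n k : nat) (p : R)
    (E : {set {set 'I_n}}) : 0 < p <= 1 ->
  258 * k.+1%:R <= ln n%:R :> R ->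
  (forall Z : {set 'I_n}, 32 * ln n%:R / p <= #|Z|%:R ->
     p * 'C(#|Z|, 2)%:R / 4 <= #|edges_in E Z|%:R) ->
  ln (num_orientations E (dicycle k.+3))%:R <= n%:R / p * ln (n%:R : R) ^+ 2.
Proof.
move=> /andP[p0 p1] lnn dense; set L : R := k.+1%:R in lnn.
have L1 : 1 <= L by rewrite ler1n.
set y : R := ln n%:R in lnn dense *.
have y0 : 0 < y by lra.
have n0 : 0 < n%:R :> R.
  by rewrite ltNge; apply/negP => /ln0 h; move: y0; rewrite /y h ltxx.
(* Taking [c = p / 16] below gives the shrinking rate [q = p / (128 * L)]; [x] solves
   [q * x = ln n], the depth at which [n * expR (- (q * x))] drops to 1. *)
pose x : R := 128 * L * y / p.
have xp : x * p = 128 * L * y by rewrite /x; field; lra.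
have Ly : L <= L * y by rewrite ler_peMr //; lra.
have Lx : 128 * (L * y) <= x.
  by rewrite /x ler_pdivlMr // mulrA ler_piMr //; rewrite mulr_ge0 //; lra.
have x0 : 0 <= x by lra.
(* K serves both as the size below which a set is not branched on and as the
   depth of the branching. *)
pose K := (Num.trunc x).+1.
have /andP[Kle Kgt] := truncn_itv x0; rewrite -/K in Kgt.
have Kx : K%:R <= x + 1 by rewrite -natr1 lerD2r.
have bound : (num_orientations E (dicycle k.+3) <= 2 ^ ((K + K) * n))%N.
  rewrite -[X in (_ * X)%N]card_ord.
  (* ['C(z, 2) >= z ^ 2 / 4] turns [p / 4] into [p / 16]; it is used for [z >= 2], hence the
     maximum. *)
  apply: (@num_orientations_le R (p / 16) (Num.max 2 (32 * y / p))).
  - apply/andP; split; lra.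
  - move=> Z; rewrite ge_max => /andP[Z2 hZ]; apply: le_trans (dense Z hZ).
    have Z2' : (2 <= #|Z|)%N by rewrite -(ler_nat R).
    have : p * (#|Z|%:R ^+ 2 / 4) <= p * 'C(#|Z|, 2)%:R.
      by rewrite ler_pM2l // bin2_ge.
    lra.
  - rewrite -/L; lra.
  - rewrite -/L maxr_pMr; last by lra.
    rewrite ge_max; apply/andP; split; first by lra.
    apply: le_trans (ltW Kgt); rewrite le_eqVlt; apply/orP; left; apply/eqP.
    by rewrite /x; ring.
  - have h1 : p * x <= p * K%:R by rewrite ler_pM2l // ltW.
    have h2 : L * (L + 1) <= L * y by rewrite ler_pM2l; lra.
    rewrite -[k.+2%:R]natr1 -/L; lra.
  rewrite card_ord -/L; set q := p / 16 / (8 * L).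
  have qx : q * x = y by rewrite /q /x; field; lra.
  have q0 : 0 <= q by rewrite !divr_ge0 //; lra.
  have q1 : q <= 1 by rewrite /q ler_pdivrMr; lra.
  apply: le_trans (_ : n%:R * expR (- q) ^+ K <= _).
    rewrite ler_pM2l // lerXn2r ?nnegrE ?expR_ge0 ?subr_ge0 //.
    exact: expR_ge1Dx.
  have yK : y <= q * K%:R by rewrite -qx ler_wpM2l // ltW.
  rewrite -expRM_natr mulNr.
  apply: le_trans (_ : n%:R * expR (- y) <= _).
    by rewrite ler_pM2l // ler_expR lerN2.
  by rewrite expRN lnK // divff ?gt_eqF // ler1n.
have Ln0 : 0 <= n%:R / p by rewrite divr_ge0 // ltW.
(* [ln] is 0 at 0, so a vanishing count satisfies the bound. *)
have [/eqP N0|N0] := posnP (num_orientations E (dicycle k.+3)).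
  by rewrite (eqP N0) ln0 // mulr_ge0 // sqr_ge0.
apply: le_trans (_ : ln (2 ^+ ((K + K) * n)) <= _).
  by rewrite ler_ln ?posrE ?ltr0n ?exprn_gt0 // -natrX ler_nat.
rewrite lnXn // -[leLHS]mulr_natr.
have ln2 : ln 2 <= 1 :> R.
  by rewrite -[leRHS]expRK ler_ln ?posrE ?expR_gt0 // (le_trans _ (expR_ge1Dx 1)) //; lra.
apply: le_trans (_ : 1 * ((K + K) * n)%N%:R <= _); first by rewrite ler_wpM2r.
rewrite mul1r natrM natrD.
have yL : 0 <= y - 258 * L by rewrite subr_ge0.
have : 0 <= n%:R * (y * (y - 258 * L)) / p.
  by exact: divr_ge0 (mulr_ge0 (ltW n0) (mulr_ge0 (ltW y0) yL)) (ltW p0).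
(* [2 * K * p <= 2 * (x + 1) * p <= 256 * L * y + 2], and [2 <= 2 * L * y]: hence 258. *)
have h : n%:R * (K%:R + K%:R) <= n%:R * (258 * L * y / p).
  rewrite ler_pM2l // ler_pdivlMr //.
  have : K%:R * p <= (x + 1) * p by rewrite ler_pM2r.
  lra.
have -> : n%:R * (y * (y - 258 * L)) / p
  = n%:R / p * y ^+ 2 - n%:R * (258 * L * y / p) by field; lra.
rewrite subr_ge0; apply: le_trans; rewrite mulrC; exact: h.
Qed.

Local Open Scope classical_set_scope.
Local Open Scope ring_scope.

Theorem theorem6p1 (R : realType) (r : nat) (hr : (3 <= r)%N) :
  exists C : R, forall p : nat -> R,
    (forall n, 0 < p n <= 1) ->
    gnp_prob (p n) (fun E : {set {set 'I_n}} =>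
        ln (num_orientations E (dicycle r))%:R
          <= n%:R / p n * ln (n%:R : R) `^ C)
      @[n --> \oo] --> (1 : R).
Proof.
(* Here [k.+1 = r - 2]. The count gives a constant times [n * ln n / p], and a second logarithm
   absorbs the constant. *)
case: r hr => [|[|[|k]]] // _; exists 2%:R => p hp.
apply: (squeeze_cvgr (f := fun n => 2 - expR n%:R^-1) (h := fun=> 1)).
- near=> n; rewrite gnp_prob_le1 // andbT.
  have n0 : 0 < n%:R :> R by rewrite ltr0n; near: n; exact: nbhs_infty_gt.
  have nL : expR (258 * k.+1%:R) <= n%:R :> R by near: n; exact: nbhs_infty_ger.
  have lnn : 258 * k.+1%:R <= ln n%:R :> R.
    by rewrite -[leLHS]expRK ler_ln ?posrE ?expR_gt0.
  have k1 : 1 <= k.+1%:R :> R by rewrite ler1n.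
  pose D (X : {set 'I_n}) := 32 * ln n%:R / p n <= #|X|%:R.
  apply: le_trans (gnp_prob_ge (D := D) (hp n) _).
    have := @sum_dense_failure_le R n (p n) D (hp n).
    move=> /(_ _ (fun _ h => h)) h; have {h} := h; lra.
  move=> E _ dense; rewrite powR_mulrn; last by lra.
  exact: ln_num_orientations_le.
- have inv0 : (n%:R : R)^-1 @[n --> \oo] --> (0 : R).
    apply/gtr0_cvgV0; last exact: cvgr_idn.
    by near=> n; rewrite ltr0n; near: n; exact: nbhs_infty_gt.
  have := cvgB (cvg_cst (2 : R)) (cvg_comp _ _ inv0 (@continuous_expR R 0)).
  rewrite [2 - expR 0](_ : _ = 1); last by rewrite expR0; lra.
  exact.
- exact: cvg_cst.
Unshelve. all: by end_near. Qed.
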